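(* Let $(A,u)$ be an archimedean vector lattice with distinguished weak order unit, with Yosida representation $A \leq D(YA)$, and let $\tau : X \to YA$ be a cover with $X$ a zero-dimensional compact Hausdorff space. Let $G = G(A,\tau) \subseteq D(X)$ be the group generated in $D(X)$ by all functions $(a\circ\tau)\chi(U)$ with $a \in A$ and $U \subseteq X$ clopen. Then $G$ is a vector lattice, thus (with the constant function $1$ as distinguished weak order unit) an archimedean vector lattice with weak order unit, with Yosida space $YG = X$. Moreover $\lambda G = \operatorname{clop}(YG)$, so $G$ is local and $G$ has SMP (sufficiently many projections).
   Context: For compact Hausdorff $X$, $D(X)$ is the set of continuous $f : X \to \mathbb{R} \cup \{\pm\infty\}$ with $f^{-1}(\mathbb{R})$ dense in $X$; it is a lattice under pointwise order, closed under multiplication by real scalars, with addition only partially defined: $f+g=h$ in $D(X)$ means $h \in D(X)$ and $h(x)=f(x)+g(x)$ on the dense set where $f$ and $g$ are both finite. A weak order unit of a vector lattice $A$ is $u>0$ such that $|a|\wedge u = 0$ implies $a=0$. For $(A,u)$ an archimedean vector lattice with distinguished weak order unit, the Yosida space $YA$ is the compact Hausdorff space of all ideals $M$ of $A$ maximal with respect to $u \notin M$, with the hull-kernel topology. The Yosida representation is a vector lattice isomorphism $\eta$ of $A$ onto a subset $\eta(A) \subseteq D(YA)$ (with all sums of elements of $\eta(A)$ existing in $D(YA)$ and lying in $\eta(A)$) with $\eta(u)=1$ and such that $\eta(A)$ 0-1 separates disjoint closed sets of $YA$ (for disjoint closed $E,F$ some element is $0$ on $E$ and $1$ on $F$). One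 identifies $A$ with $\eta(A)$ and writes $A \leq D(YA)$. For a vector lattice $G \subseteq D(X)$ containing the constant $1$ as distinguished unit, ''$YG = X$'' means that the inclusion $G \subseteq D(X)$ is the Yosida representation of $G$, up to a homeomorphism of $X$ with $YG$. A cover is a continuous surjection $\tau: X \to Y$ of compact Hausdorff spaces that is irreducible: if $F \subseteq X$ is closed and $F \neq X$, then $\tau(F) \neq Y$. If $\tau: X \to YA$ is a cover then $a \circ \tau \in D(X)$ for all $a \in A$. A space is zero-dimensional (ZD) if its clopen sets form a base; $\operatorname{clop}(X)$ is the family of clopen subsets of $X$. For $f \in D(X)$ and $U$ clopen, $f\chi(U) \in D(X)$ is the function equal to $f$ on $U$ and $0$ off $U$. The sums used to generate $G$ all exist in $D(X)$, via $(a_1\circ\tau)\chi(U_1)+(a_2\circ\tau)\chi(U_2) = (a_1\circ\tau)\chi(U_1 - U_2)+((a_1+a_2)\circ\tau)\chi(U_1\cap U_2)+(a_2\circ\tau)\chi(U_2-U_1)$; thus $G$ consists exactly of the finite sums $\sum_{i=1}^n (a_i\circ\tau)\chi(U_i)$ with $a_i \in A$ and the $U_i$ pairwise disjoint clopen subsets of $X$. For an archimedean vector lattice $G$ with distinguished weak order unit, identified with its image under its Yosida representation $G \leq D(YG)$: $\lambda G$ is the family of all $U \in \operatorname{clop}(YG)$ such that $g\chi(U)\in G$ for every $g \in G$. An $f \in D(YG)$ is locally in $G$ if for every $x \in YG$ there are an open neighborhood $U_x$ of $x$ and $g_x \in G$ with $f(y)=g_x(y)$ for all $y \in U_x$; $G$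 is local if every $f \in D(YG)$ that is locally in $G$ belongs to $G$. A band is an ideal closed under existing suprema of subsets of its elements; a projection band of $G$ is a band $B$ for which $G = B \oplus B'$ for some band $B' \subseteq G$. $G$ has sufficiently many projections (SMP) if each nonzero band contains a nonzero projection band. *)

(* Defs.v *)
From HB Require Import structures.
From mathcomp Require Import all_boot all_order all_algebra.
From mathcomp Require Import all_classical all_reals all_analysis.

Set Implicit Arguments.
Unset Strict Implicit.
Unset Printing Implicit Defensive.

Import Order.TTheory GRing.Theory Num.Theory.

Local Open Scope classical_set_scope.
Local Open Scope ring_scope.

(* The lattice operations are part of the mixin because MathComp's hierarchy
   does not allow Order.Lattice to be joined with GRing.Lmodule downstream of
   Num.RealDomain.  The two equivalences say that they are the binary supremum
   and infimum of the order. *)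

HB.mixin Record Lmodule_isVectorLattice (R : realType) L
    of GRing.Lmodule R L & Order.POrder ring_display L := {
  vl_join : L -> L -> L;
  vl_meet : L -> L -> L;
  vl_leUx : forall a b c : L, (vl_join a b <= c) = (a <= c) && (b <= c);
  vl_lexI : forall a b c : L, (c <= vl_meet a b) = (c <= a) && (c <= b);
  vl_leD2r : forall c a b : L, a <= b -> a + c <= b + c;
  vl_scale_ge0 : forall (r : R) (a : L), 0 <= r -> 0 <= a -> 0 <= r *: a
}.

#[short(type="vectorLatticeType")]
HB.structure Definition VectorLattice (R : realType) :=
  { L of GRing.Lmodule R L & Order.POrder ring_display L &
         Lmodule_isVectorLattice R L }.

Section VectorLatticeDefs.
Context {R : realType} {L : vectorLatticeType R}.
Implicit Types (a b u : L) (B I M : set L).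

Definition vabs a : L := vl_join a (- a).

Definition weak_order_unit u : Prop :=
  0 < u /\ forall a, vl_meet (vabs a) u = 0 -> a = 0.

Record vl_ideal I : Prop := VlIdeal {
  vl_ideal0 : I 0;
  vl_idealD : forall a b, I a -> I b -> I (a + b);
  vl_idealZ : forall (r : R) a, I a -> I (r *: a);
  vl_ideal_solid : forall a b, vabs a <= vabs b -> I b -> I a
}.

Definition maximal_avoiding u M : Prop :=
  [/\ vl_ideal M, ~ M u &
      forall I, vl_ideal I -> ~ I u -> M `<=` I -> I = M].

Definition band B : Prop :=
  vl_ideal B /\ forall S s, S `<=` B -> supremums S s -> B s.

Definition projection_band B : Prop :=
  band B /\ exists B', [/\ band B', B `&` B' = [set 0] &
    forall g, exists b b', [/\ B b, B' b' & g = b + b']].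

End VectorLatticeDefs.

Definition archimedean_vl (R : realType) (L : vectorLatticeType R) : Prop :=
  forall a b : L, 0 <= a -> (forall n : nat, a *+ n <= b) -> a = 0.

Definition sufficiently_many_projections (R : realType)
    (L : vectorLatticeType R) : Prop :=
  forall B : set L, band B -> B <> [set 0] ->
    exists C : set L, [/\ projection_band C, C <> [set 0] & C `<=` B].

(* The ideals maximal with respect to avoiding u are prime; this is what makes
   the complements of hulls stable under finite intersections. *)

Section Primeness.
Context {R : realType} {L : vectorLatticeType R}.
Implicit Types (a b c d u x y : L) (I M : set L).

Lemma vl_lerD a b c d : a <= b -> c <= d -> a + c <= b + d.
Proof.
move=> ab cd; apply: le_trans (vl_leD2r c _ _ ab) _.
by rewrite ![b + _]addrC; apply: vl_leD2r.
Qed.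

Lemma vl_subr_ge0 a b : (0 <= b - a) = (a <= b).
Proof.
apply/idP/idP => h; first by have := vl_leD2r a _ _ h; rewrite add0r subrK.
by have := vl_leD2r (- a) _ _ h; rewrite subrr.
Qed.

Lemma vl_lerZ (r : R) a b : 0 <= r -> a <= b -> r *: a <= r *: b.
Proof.
by move=> r0 ab; rewrite -vl_subr_ge0 -scalerBr vl_scale_ge0// vl_subr_ge0.
Qed.

Lemma vabs_leP x b : (vabs x <= b) = (x <= b) && (- x <= b).
Proof. exact: vl_leUx. Qed.

Lemma le_vabs x : x <= vabs x.
Proof. by have := lexx (vabs x); rewrite vabs_leP => /andP[]. Qed.

Lemma leN_vabs x : - x <= vabs x.
Proof. by have := lexx (vabs x); rewrite vabs_leP => /andP[]. Qed.

Lemma vabsN x : vabs (- x) = vabs x.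
Proof.
apply/le_anti; rewrite !vabs_leP opprK le_vabs leN_vabs.
by rewrite -[X in X <= _]opprK leN_vabs le_vabs.
Qed.

Lemma vabs_ge0 x : 0 <= vabs x.
Proof.
have h : 0 <= vabs x + vabs x.
  by rewrite -(subrr x); apply: vl_lerD; [exact: le_vabs|exact: leN_vabs].
have -> : vabs x = 2^-1 *: (vabs x + vabs x).
  by rewrite -mulr2n -[vabs x *+ 2]scaler_nat scalerA mulVf ?scale1r.
apply: vl_scale_ge0; last exact: h.
by rewrite invr_ge0.
Qed.

Lemma vabs_id x : 0 <= x -> vabs x = x.
Proof.
move=> x0; apply/le_anti; rewrite le_vabs andbT vabs_leP lexx /=.
by apply: (le_trans _ x0); rewrite -vl_subr_ge0 sub0r opprK.
Qed.

Lemma vabsD x y : vabs (x + y) <= vabs x + vabs y.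
Proof.
by rewrite vabs_leP opprD; apply/andP; split; apply: vl_lerD;
  rewrite ?le_vabs ?leN_vabs.
Qed.

Lemma vabsZ_le (r : R) x : vabs (r *: x) <= `|r| *: vabs x.
Proof.
wlog r0 : r x / 0 <= r => [hw|].
  have [/hw//|/ltW r0] := leP 0 r.
  have -> : r *: x = (- r) *: (- x) by rewrite scalerN scaleNr opprK.
  by rewrite -normrN -(vabsN x); apply: hw; rewrite oppr_ge0.
rewrite ger0_norm// vabs_leP -scalerN.
by apply/andP; split; apply: vl_lerZ; rewrite ?le_vabs ?leN_vabs.
Qed.

Lemma vl_ideal_vabs I a : vl_ideal I -> I a -> I (vabs a).
Proof.
by move=> hI; apply: vl_ideal_solid => //; rewrite vabs_id// vabs_ge0.
Qed.

Lemma vl_ideal_le I x y : vl_ideal I -> 0 <= x -> x <= y -> I y -> I x.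
Proof.
move=> hI x0 xy; apply: vl_ideal_solid => //.
by rewrite !vabs_id// (le_trans x0 xy).
Qed.

Lemma maximal_avoiding_adjoin u M a : maximal_avoiding u M -> ~ M a ->
  exists m (r : R), [/\ M m, 0 <= m, 0 <= r & vabs u <= m + r *: vabs a].
Proof.
case=> hM Mu maxM Ma.
pose I : set L := [set x | exists m (r : R),
  [/\ M m, 0 <= m, 0 <= r & vabs x <= m + r *: vabs a]].
have MI : M `<=` I.
  move=> x Mx; exists (vabs x), 0.
  by rewrite scale0r addr0; split=> //; [exact: vl_ideal_vabs|exact: vabs_ge0].
have Ia : I a.
  by exists 0, 1; rewrite add0r scale1r; split=> //; exact: vl_ideal0.
suff hI : vl_ideal I.
  by have [//|Iu] := pselect (I u); move: Ma; rewrite -(maxM I).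
split.
- exact/MI/(vl_ideal0 hM).
- move=> x y [m [r [Mm m0 r0 xm]]] [m' [r' [Mm' m'0 r'0 ym]]].
  exists (m + m'), (r + r'); split; first exact: vl_idealD.
  + by rewrite -(addr0 0); apply: vl_lerD.
  + exact: addr_ge0.
  + apply: le_trans (vabsD _ _) _.
    by rewrite scalerDl addrACA; apply: vl_lerD.
- move=> s x [m [r [Mm m0 r0 xm]]].
  exists (`|s| *: m), (`|s| * r); split; first exact: vl_idealZ.
  + exact: vl_scale_ge0.
  + exact: mulr_ge0.
  + apply: le_trans (vabsZ_le _ _) _.
    by rewrite -scalerA -scalerDr; apply: vl_lerZ.
- move=> x y xy [m [r [Mm m0 r0 ym]]]; exists m, r; split => //.
  exact: (le_trans xy ym).
Qed.

Lemma maximal_avoiding_prime u M a b : maximal_avoiding u M ->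
  M (vl_meet (vabs a) (vabs b)) -> M a \/ M b.
Proof.
move=> uM Mab; have [|Ma] := pselect (M a); first by left.
have [|Mb] := pselect (M b); first by right.
have [hM Mu _] := uM; exfalso; apply: Mu.
have [m [r [Mm m0 r0 um]]] := maximal_avoiding_adjoin uM Ma.
have [m' [r' [Mm' m'0 r'0 um']]] := maximal_avoiding_adjoin uM Mb.
pose k := r + r' + 1.
have k0 : 0 < k by rewrite ltr_wpDl// addr_ge0.
have step (p n : L) (s : R) c : 0 <= n -> s <= k ->
    vabs u <= p + s *: vabs c -> k^-1 *: (vabs u - (p + n)) <= vabs c.
  move=> n0 sk h.
  rewrite -[leRHS]scale1r -(mulVf (lt0r_neq0 k0)) -scalerA.
  apply: vl_lerZ; first by rewrite invr_ge0 ltW.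
  rewrite -vl_subr_ge0 opprB [k *: _ + _]addrC addrAC vl_subr_ge0.
  apply: le_trans h _; apply: vl_lerD.
    by rewrite -[leLHS]addr0; apply: vl_lerD.
  by rewrite -vl_subr_ge0 -scalerBl vl_scale_ge0 ?subr_ge0// vabs_ge0.
have ua : k^-1 *: (vabs u - (m + m')) <= vabs a.
  by apply: (step _ _ _ _ m'0 _ um); rewrite /k -addrA lerDl addr_ge0.
have ub : k^-1 *: (vabs u - (m + m')) <= vabs b.
  rewrite [m + m']addrC.
  by apply: (step _ _ _ _ m0 _ um'); rewrite /k addrAC lerDr addr_ge0.
pose z := (m + m') + k *: vl_meet (vabs a) (vabs b).
have Mz : M z.
  by apply: vl_idealD => //; [exact: vl_idealD|exact: vl_idealZ].
apply: vl_ideal_solid Mz => //; apply: (le_trans _ (le_vabs z)).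
rewrite -vl_subr_ge0 /z addrAC -[X in 0 <= X]addrC.
have : k^-1 *: (vabs u - (m + m')) <= vl_meet (vabs a) (vabs b).
  by rewrite vl_lexI ua.
move=> /(vl_lerZ (ltW k0)); rewrite scalerA mulfV ?lt0r_neq0// scale1r.
by rewrite -vl_subr_ge0 opprB.
Qed.

End Primeness.

(* The Yosida space, with the hull-kernel topology: the closed sets are the
   hulls {M | S `<=` M}, so the open sets are the sets {M | ~ (S `<=` M)}. *)

Record yosida_space (R : realType) (L : vectorLatticeType R) (u : L) :=
  YosidaPoint {
    yosida_ideal :> set L;
    yosida_idealP : maximal_avoiding u yosida_ideal
  }.

HB.instance Definition _ (R : realType) (L : vectorLatticeType R) (u : L) :=
  gen_eqMixin (yosida_space u).
HB.instance Definition _ (R : realType) (L : vectorLatticeType R) (u : L) :=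
  gen_choiceMixin (yosida_space u).

Section HullKernel.
Context {R : realType} {L : vectorLatticeType R} (u : L).

Definition hull (S : set L) : set (yosida_space u) := [set M | S `<=` M].

Definition hull_kernel_open (U : set (yosida_space u)) : Prop :=
  exists S : set L, U = ~` hull S.

Let hkT : hull_kernel_open setT.
Proof.
exists setT; apply/esym; rewrite -subTset => M _ TM.
by have [_ Mu _] := yosida_idealP M; apply/Mu/TM.
Qed.

Let hkI : setI_closed hull_kernel_open.
Proof.
move=> _ _ [S ->] [T ->].
exists [set vl_meet (vabs a) (vabs b) | a in S & b in T].
rewrite -setCU; congr (~` _); apply/seteqP; split=> M /=.
  have [hM _ _] := yosida_idealP M.
  have meet0 a b : 0 <= vl_meet (vabs a) (vabs b).
    by rewrite vl_lexI !vabs_ge0.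
  move=> STM _ [a Sa [b Tb <-]].
  have /andP[lea leb] : (vl_meet (vabs a) (vabs b) <= vabs a) &&
    (vl_meet (vabs a) (vabs b) <= vabs b) by rewrite -vl_lexI.
  case: STM => h.
    exact: vl_ideal_le lea (vl_ideal_vabs hM (h _ Sa)).
  exact: vl_ideal_le leb (vl_ideal_vabs hM (h _ Tb)).
move=> STM; have [SM|/existsNP[a /not_implyP[Sa Ma]]] := pselect (S `<=` M).
  by left.
right=> b Tb.
have [||] := @maximal_avoiding_prime _ _ u M a b (yosida_idealP M); [|by []|by []].
by apply: STM; exists a => //; exists b.
Qed.

Let hk_bigU (I : Type) (f : I -> set (yosida_space u)) :
  (forall i, hull_kernel_open (f i)) -> hull_kernel_open (\bigcup_i f i).
Proof.
move=> /choice[S fS]; exists (\bigcup_i S i).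
rewrite -[LHS]setCK setC_bigcup; congr (~` _); apply/seteqP; split=> M /=.
  by move=> h a [i _ Sia]; have := h i Logic.I; rewrite fS setCK; exact.
by move=> h i _; rewrite fS setCK => a Sia; apply: h; exists i.
Qed.

HB.instance Definition _ :=
  isOpenTopological.Build (yosida_space u) hkT hkI hk_bigU.

End HullKernel.

Section DX.
Context {R : realType} {X : topologicalType}.
Implicit Types (f g h : X -> \bar R) (G S : set (X -> \bar R)).
Local Open Scope ereal_scope.

Definition DX : set (X -> \bar R) :=
  [set f | continuous f /\ dense [set x | f x \is a fin_num]].

(* the partial addition of D(X): "f + g = h in D(X)" *)
Definition DX_add f g h : Prop :=
  DX h /\ forall x, f x \is a fin_num -> g x \is a fin_num -> h x = f x + g x.

(* D(X) is not a group: closure under addition refers to those sums which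
   exist in D(X). *)
Definition DX_subgroup S : Prop :=
  [/\ S `<=` DX, S (cst 0), forall f, S f -> S (fun x => - f x) &
      forall f g h, S f -> S g -> DX_add f g h -> S h].

(* The default value of \bar R being 0, f \_ U is the function f chi(U). *)
Definition lambda_clopens G : set (set X) :=
  [set U | clopen U /\ forall g, G g -> G (g \_ U)].

Definition locally_in G f : Prop :=
  DX f /\ forall x : X, exists2 g, G g & \forall y \near x, f y = g y.

Definition is_local G : Prop := forall f, locally_in G f -> G f.

Definition zero_one_separates G : Prop :=
  forall E F : set X, closed E -> closed F -> E `&` F = set0 ->
    exists g, [/\ G g, forall x, E x -> g x = 0 & forall x, F x -> g x = 1].

(* By rep_add, all sums of elements of range rho exist in D(X) and lie in
   range rho. *)
Record DX_representation (L : vectorLatticeType R)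
    (rho : L -> X -> \bar R) : Prop := DXRepresentation {
  rep_inj : injective rho;
  rep_DX : forall a, DX (rho a);
  rep_add : forall a b, DX_add (rho a) (rho b) (rho (a + b)%R);
  rep_scale : forall (r : R) a, rho (r *: a)%R = (fun x => r%:E * rho a x);
  rep_join : forall a b,
    rho (vl_join a b) = (fun x => maxe (rho a x) (rho b x));
  rep_meet : forall a b,
    rho (vl_meet a b) = (fun x => mine (rho a x) (rho b x))
}.

End DX.

Arguments DX {R} X.

(* These properties determine eta up to an autohomeomorphism of the Yosida
   space; no particular choice is made. *)
Record yosida_representation (R : realType) (L : vectorLatticeType R) (u : L)
    (eta : L -> yosida_space u -> \bar R) : Prop := YosidaRepresentation {
  yosida_rep : DX_representation eta;
  yosida_unit : eta u = cst 1%E;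
  yosida_sep : zero_one_separates (range eta)
}.

(* "YL = X" for a vector lattice L identified by rho with a subset of D(X) *)
Definition yosida_space_is (R : realType) (L : vectorLatticeType R) (u : L)
    (X : topologicalType) (rho : L -> X -> \bar R) : Prop :=
  exists (eta : L -> yosida_space u -> \bar R)
         (phi : X -> yosida_space u) (psi : yosida_space u -> X),
    [/\ yosida_representation eta,
        continuous phi /\ continuous psi,
        cancel phi psi /\ cancel psi phi &
        forall a, rho a = eta a \o phi].

Definition is_cover (X Y : topologicalType) (tau : X -> Y) : Prop :=
  [/\ compact [set: X] /\ hausdorff_space X,
      compact [set: Y] /\ hausdorff_space Y,
      continuous tau, range tau = [set: Y] &
      forall F, closed F -> F != [set: X] -> tau @` F != [set: Y]].

(* The library's zero_dimensional only asks that clopen sets separate points. *)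
Definition has_clopen_base (X : topologicalType) : Prop :=
  basis [set U : set X | clopen U].

Definition cover_group (R : realType) (A : vectorLatticeType R) (u : A)
    (eta : A -> yosida_space u -> \bar R) (X : topologicalType)
    (tau : X -> yosida_space u) : set (X -> \bar R) :=
  smallest DX_subgroup
    [set f | exists (a : A) (U : set X),
       clopen U /\ f = (eta a \o tau) \_ U].

(* Main.v *)
From HB Require Import structures.
Require Import Defs.
From mathcomp Require Import all_boot all_order all_algebra.
From mathcomp Require Import all_classical all_reals all_analysis.

(* Call a function on X a local pullback if near every point it has the form
   a o tau.  Irreducibility of tau makes preimages of dense open sets dense, so
   local pullbacks lie in D(X); sums exist because they exist locally and
   elements of D(X) agreeing on a dense set are equal.  By compactness and
   zero-dimensionality G(A, tau) is the set of all local pullbacks, a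
   description from which closure under the lattice operations, under chi(U)
   for U clopen, and locality are immediate.  Since G contains each chi(U), the
   ideals maximal with respect to avoiding 1 are the zero ideals
   {g | g x = 0}, whence YG = X; the same argument shows that the values of any
   Yosida representation can be read off its zero ideals, so it agrees with the
   inclusion in D(X) up to a homeomorphism.  For SMP, a nonzero band contains
   chi(U) for some nonempty clopen U, hence all elements vanishing off U. *)

Set Implicit Arguments.
Unset Strict Implicit.
Unset Printing Implicit Defensive.

Import Order.TTheory GRing.Theory Num.Theory.

Local Open Scope classical_set_scope.
Local Open Scope ring_scope.

(** * Compactness and density arguments *)

(** Stands in for the extraction of finite subcovers. If [P setT] failed, the complements of the
    sets satisfying [P] would form a proper filter, and a cluster point of it would contradict the
    local hypothesis. *)
Lemma compact_set_ind (X : topologicalType) (P : set X -> Prop) :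
  compact [set: X] ->
  (forall A B, A `<=` B -> P B -> P A) ->
  P set0 -> (forall A B, P A -> P B -> P (A `|` B)) ->
  (forall x : X, exists2 U, nbhs x U & P U) ->
  P setT.
Proof.
move=> cX Psub P0 PU Ploc; apply: contrapT => nPT.
pose F : set_system X := [set A | P (~` A)].
have FF : ProperFilter F.
  split; first by rewrite /F /= setC0.
  split; first by rewrite /F /= setCT.
  - by move=> A B; rewrite /F /= setCI; exact: PU.
  - by move=> A B AB; rewrite /F /=; apply: Psub; exact: subsetC.
have [|x [_ Fx]] := cX F FF; first by rewrite /F /= setCT.
have [U Ux PUx] := Ploc x.
have [|y []//] := Fx (~` U) U _ Ux.
by rewrite /F /= setCK.
Qed.

Lemma dense_open_meet (X : topologicalType) (D : set X) (x : X) (U : set X) :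
  dense D -> nbhs x U -> exists2 y, U y & D y.
Proof.
move=> dD; rewrite nbhsE => -[B [oB Bx] BU].
by have [|y [/BU Uy Dy]] := dD B _ oB; [exists x|exists y].
Qed.

(** Different values at [x] would have disjoint neighborhoods; their preimages meet in a
    neighborhood of [x], which contains a point of [D] where the values agree. *)
Lemma near_eq_dense (X Y : topologicalType) (f g : X -> Y) (D : set X) (x : X) :
  hausdorff_space Y -> continuous f -> continuous g -> dense D ->
  (\forall y \near x, D y -> f y = g y) -> f x = g x.
Proof.
rewrite open_hausdorff => hY cf cg dD fgD; apply: contrapT => /eqP /hY[[A B] /=].
rewrite !inE => -[Afx Bgx] [oA oB AB0].
have fA : nbhs x (f @^-1` A) by apply: cf; exact: open_nbhs_nbhs.
have gB : nbhs x (g @^-1` B) by apply: cg; exact: open_nbhs_nbhs.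
have [y [[/= Ay By] fgy] Dy] :=
  dense_open_meet dD (filterI (filterI fA gB) fgD).
have : (A `&` B) (f y) by split => //; rewrite fgy.
by rewrite AB0.
Qed.

(** * Elements of [D(X)] and the uniqueness of their sums *)

Section ExtendedRealFunctions.
Context {R : realType} {X : topologicalType}.
Implicit Types (f g h : X -> \bar R).

Lemma open_fin_num f : continuous f -> open [set x | f x \is a fin_num].
Proof.
move=> cf.
have -> : [set x | f x \is a fin_num] =
    f @^-1` ([set y | -oo < y]%E `&` [set y | y < +oo]%E).
  by apply/seteqP; split=> x /=; rewrite fin_numE ltNye ltey => /andP.
by move/continuousP: cf; apply; apply: openI;
  [exact: open_ereal_gt_ereal|exact: open_ereal_lt_ereal].
Qed.

Lemma open_gt_cst f (r : \bar R) : continuous f -> open [set x | r < f x]%E.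
Proof. by move/continuousP/(_ _ (@open_ereal_gt_ereal _ r)). Qed.

Lemma dense_fin_num2 f g : DX X f -> DX X g ->
  dense [set x | f x \is a fin_num /\ g x \is a fin_num].
Proof. by move=> [cf df] [cg dg]; apply: denseI => //; exact: open_fin_num. Qed.

Lemma DX_eq_near (x : X) (f g : X -> \bar R) (D : set X) :
  DX X f -> DX X g -> dense D -> (\forall y \near x, D y -> f y = g y) ->
  f x = g x.
Proof. by move=> [cf _] [cg _]; apply: near_eq_dense => //; exact: ereal_hausdorff. Qed.

Lemma DX_eq (f g : X -> \bar R) (D : set X) :
  DX X f -> DX X g -> dense D -> (forall y, D y -> f y = g y) -> f = g.
Proof.
move=> Df Dg dD fg; apply/funext => x; apply: (DX_eq_near Df Dg dD).
exact: nearW.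
Qed.

Lemma DX_add_unique f g h h' : DX X f -> DX X g -> DX_add f g h -> DX_add f g h' ->
  h = h'.
Proof.
move=> Df Dg [Dh fgh] [Dh' fgh']; apply: (DX_eq Dh Dh' (dense_fin_num2 Df Dg)).
by move=> x /= [fx gx]; rewrite fgh// fgh'.
Qed.

(** Continuity and density of the finiteness set can both be tested near each point. *)
Lemma DX_local f :
  (forall x : X, exists2 g, DX X g & \forall y \near x, f y = g y) -> DX X f.
Proof.
move=> loc; split.
  move=> x; have [g [cg _] fg] := loc x.
  rewrite /continuous_at (nbhs_singleton fg : f x = g x).
  by apply: cvg_trans (cg x); apply: near_eq_cvg; near do apply/esym.
move=> O [x Ox] oO; have [g [_ dg] fg] := loc x.
have Ox' : nbhs x O by exact: open_nbhs_nbhs.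
have [y [/= fgy Oy] gy] := dense_open_meet dg (filterI fg Ox').
by exists y; split=> //=; rewrite fgy.
Unshelve. all: by end_near. Qed.

End ExtendedRealFunctions.

(** * Pointwise computation in a representation *)

Lemma vl_join_leD (R : realType) (L : vectorLatticeType R) (a b : L) :
  0 <= a -> 0 <= b -> vl_join a b <= a + b.
Proof.
move=> a0 b0; rewrite vl_leUx -{1}[a]addr0 -{2}[b]add0r.
by rewrite !vl_lerD.
Qed.

Lemma vl_ideal_vabs_inv (R : realType) (L : vectorLatticeType R) (I : set L) a :
  vl_ideal I -> I (vabs a) -> I a.
Proof.
move=> hI; apply: vl_ideal_solid => //.
by rewrite [leRHS]vabs_id// vabs_ge0.
Qed.

Section Representation.
Context {R : realType} {L : vectorLatticeType R} {X : topologicalType}.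
Variables (rho : L -> X -> \bar R).
Hypothesis rep : DX_representation rho.
Implicit Types (a b c : L) (x : X).

Lemma rep0 x : rho 0 x = 0%E.
Proof. by rewrite -(scale0r 0) (rep_scale rep) mul0e. Qed.

Lemma repN a x : rho (- a) x = (- rho a x)%E.
Proof. by rewrite -scaleN1r (rep_scale rep) EFinN mulN1e. Qed.

Lemma rep_vabs a x : rho (vabs a) x = `|rho a x|%E.
Proof.
rewrite /vabs (rep_join rep) repN.
case: (rho a x) => [r| |] //; rewrite ?abse_EFin -?EFinN -?EFin_max.
by congr (_%:E); rewrite maxrN.
Qed.

(** Since [a <= b] means that [b] is the join of [a] and [b], preservation of joins and injectivity
    make the order pointwise. *)
Lemma rep_leP a b : a <= b <-> forall x, (rho a x <= rho b x)%E.
Proof.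
split=> [ab x|ab].
  have -> : b = vl_join a b.
    apply/le_anti; rewrite vl_leUx ab lexx !andbT.
    by have := lexx (vl_join a b); rewrite vl_leUx => /andP[].
  by rewrite (rep_join rep) le_max lexx.
have -> : b = vl_join a b.
  by apply: (rep_inj rep); rewrite (rep_join rep); apply/funext => x;
    rewrite max_r.
by have := lexx (vl_join a b); rewrite vl_leUx => /andP[].
Qed.

Lemma repD a b x : rho a x \is a fin_num -> rho b x \is a fin_num ->
  rho (a + b) x = (rho a x + rho b x)%E.
Proof. by have [_] := rep_add rep a b; apply. Qed.

Lemma repMn a n x : rho a x \is a fin_num -> rho (a *+ n) x = (n%:R%:E * rho a x)%E.
Proof. by move=> ax; rewrite -scaler_nat (rep_scale rep). Qed.

Lemma rep_eqP a b : (forall x, rho a x = rho b x) -> a = b.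
Proof. by move=> ab; apply/(rep_inj rep)/funext. Qed.

End Representation.

(** * Zero ideals of points *)

Definition zero_ideal (R : realType) (L : vectorLatticeType R) (X : Type)
  (rho : L -> X -> \bar R) (x : X) : set L := [set a | rho a x = 0%E].

Section ZeroIdeals.
Context {R : realType} {L : vectorLatticeType R} {X : topologicalType}.
Variables (e : L) (rho : L -> X -> \bar R).
Hypothesis rep : DX_representation rho.
Hypothesis unit_e : rho e = cst 1%E.
Implicit Types (a b c : L) (x : X).

Lemma zero_ideal_ideal x : vl_ideal (zero_ideal rho x).
Proof.
rewrite /zero_ideal; split=> /=.
- exact: rep0.
- by move=> a b a0 b0; rewrite (repD rep) ?a0 ?b0 ?adde0.
- by move=> r a a0; rewrite (rep_scale rep) a0 mule0.
- move=> a b /(rep_leP rep)/(_ x); rewrite !(rep_vabs rep) => ab b0.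
  apply/eqP; rewrite -abse_eq0 eq_le abse_ge0 andbT.
  by apply: le_trans ab _; rewrite b0 abse0.
Qed.

(** Turns a nonzero value at [x] into a positive element of the ideal that exceeds the unit on a
    whole neighborhood of [x]. *)
Lemma vl_ideal_bump I a x : vl_ideal I -> I a -> rho a x <> 0%E ->
  exists b, [/\ I b, 0 <= b & (1 < rho b x)%E].
Proof.
move=> hI Ia ax.
(* A finite value [r] is scaled to absolute value 2; an infinite one exceeds 1 already. *)
have [c c0 cax] : exists2 c : R, 0 <= c & (1 < c%:E * `|rho a x|)%E.
  case: (rho a x) ax => [r /eqP r0| _| _].
  - exists (2 / `|r|); first by rewrite divr_ge0.
    rewrite abse_EFin -EFinM lte_fin divfK ?normr_eq0 ?ltr1n//.
  - by exists 1 => //; rewrite mul1e ltry.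
  - by exists 1 => //; rewrite mul1e ltry.
exists (c *: vabs a); split.
- by apply: vl_idealZ => //; exact: vl_ideal_vabs.
- by apply: vl_scale_ge0 => //; exact: vabs_ge0.
- by rewrite (rep_scale rep) (rep_vabs rep).
Qed.

(** Membership in the zero ideal of [x] thus decides every real value at [x]. *)
Lemma rep_eq_finP a (r : R) x :
  rho a x = r%:E <-> rho (a - r *: e) x = 0%E.
Proof.
have re x' : rho (r *: e) x' = r%:E by rewrite (rep_scale rep) unit_e mule1.
split=> [ax|a0].
  by rewrite (repD rep) ?(repN rep) ?re ?ax// -EFinN -EFinD subrr.
by rewrite -[a](subrK (r *: e)) (repD rep) ?re ?a0// add0e.
Qed.

End ZeroIdeals.

(* An infinite value is recovered from the zero ideal because its sign is
   visible in the positive and negative parts. *)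
Lemma rep_value_eq (R : realType) (L : vectorLatticeType R) (e : L)
    (X Z : topologicalType) (rho : L -> X -> \bar R) (sigma : L -> Z -> \bar R)
    (x : X) (z : Z) :
  DX_representation rho -> DX_representation sigma ->
  rho e = cst 1%E -> sigma e = cst 1%E ->
  zero_ideal rho x = zero_ideal sigma z -> forall a, rho a x = sigma a z.
Proof.
move=> rep srep rhoe sigmae.
have key (X1 X2 : topologicalType) (rho1 : L -> X1 -> \bar R)
    (rho2 : L -> X2 -> \bar R) x1 x2 : DX_representation rho1 ->
    DX_representation rho2 -> rho1 e = cst 1%E -> rho2 e = cst 1%E ->
    zero_ideal rho1 x1 = zero_ideal rho2 x2 -> forall a (r : R),
    rho1 a x1 = r%:E -> rho2 a x2 = r%:E.
  move=> rep1 rep2 e1 e2 z12 a r /(rep_eq_finP rep1 e1) h.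
  apply/(rep_eq_finP rep2 e2).
  by have : zero_ideal rho1 x1 (a - r *: e) by []; rewrite z12.
move=> zz a.
have [[r ax]|nfin] := pselect (exists r, rho a x = r%:E).
  by rewrite ax (key _ _ _ _ _ _ rep srep rhoe sigmae zz _ _ ax).
have nfin' : ~ exists r, sigma a z = r%:E.
  move=> [r az]; apply: nfin; exists r.
  exact: (key _ _ _ _ _ _ srep rep sigmae rhoe (esym zz) _ _ az).
have join0 : rho a x = -oo%E -> sigma a z = -oo%E.
  move=> ax.
  have : zero_ideal rho x (vl_join a 0).
    by rewrite /zero_ideal /= (rep_join rep) ax (rep0 rep) maxEle leNye.
  rewrite zz /zero_ideal /= (rep_join srep) (rep0 srep).
  case: (sigma a z) nfin' => [r []||//]; first by exists r.
  by rewrite maxEle leye_eq.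
have meet0 : rho a x = +oo%E -> sigma a z = +oo%E.
  move=> ax.
  have : zero_ideal rho x (vl_meet a 0).
    by rewrite /zero_ideal /= (rep_meet rep) ax (rep0 rep) minEle leye_eq.
  rewrite zz /zero_ideal /= (rep_meet srep) (rep0 srep).
  case: (sigma a z) nfin' => [r []|//|]; first by exists r.
  by rewrite minEle leNye.
case ax: (rho a x) => [r| |]; first by case: nfin; exists r.
- by rewrite meet0.
- by rewrite join0.
Qed.

Lemma yosida_spaceP (R : realType) (L : vectorLatticeType R) (e : L)
  (M N : yosida_space e) : yosida_ideal M = yosida_ideal N -> M = N.
Proof.
case: M N => [M hM] [N hN] /= MN; case: _ / MN hN => hN.
by congr YosidaPoint; exact: Prop_irrelevance.
Qed.

(** * The points of [X] as the points of the Yosida space *)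

Section YosidaUniqueness.
Context {R : realType} {L : vectorLatticeType R} {X : topologicalType}.
Variables (e : L) (rho : L -> X -> \bar R).
Hypothesis rep : DX_representation rho.
Hypothesis unit_e : rho e = cst 1%E.
Hypothesis cX : compact [set: X].
Hypothesis hX : hausdorff_space X.
Hypothesis sep : zero_one_separates (range rho).
Implicit Types (a b c : L) (x : X).

Let closed1 x : closed [set x].
Proof. exact/accessible_closed_set1/hausdorff_accessible. Qed.

(** A larger ideal contains some [b >= 0] exceeding 1 at [x]. Separation gives [c] in the zero ideal
    equal to 1 wherever [b <= 1], so [vabs c + b] dominates the unit. *)
Lemma zero_ideal_maximal x : maximal_avoiding e (zero_ideal rho x).
Proof.
split; first exact: (zero_ideal_ideal rep).
  by rewrite /zero_ideal /= unit_e => /eqP; rewrite onee_eq0.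
move=> I hI Ie zI; apply/seteqP; split=> // a Ia; apply: contrapT => ax.
apply: Ie; have [b [Ib b0 bx]] := vl_ideal_bump rep hI Ia ax.
have [||_ [[c _ <-] cx cE]] := sep (@closed1 x) (F := [set y | rho b y <= 1]%E).
- have -> : [set y | (rho b y <= 1)%E] = ~` [set y | 1 < rho b y]%E.
    by apply/seteqP; split=> y /=; rewrite leNgt => /negP.
  by apply: open_closedC; apply: open_gt_cst; have [] := rep_DX rep b.
- by apply/seteqP; split=> // y [/= -> ]; rewrite leNgt bx.
have Ic : I c by apply: zI; exact: cx.
apply: (vl_ideal_le hI _ (y := vabs c + b)).
- by apply/(rep_leP rep) => y; rewrite (rep0 rep) unit_e lee01.
(* The comparison passes through the join because a sum is computed pointwise only where both terms
   are finite. *)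
- apply: le_trans (vl_join_leD (vabs_ge0 _) b0).
  apply/(rep_leP rep) => y; rewrite unit_e (rep_join rep) (rep_vabs rep) le_max.
  case: (leP (rho b y) 1%E) => [by1|/ltW->]; last by rewrite orbT.
  by rewrite (cE y by1) abse1 lexx.
- by apply: vl_idealD => //; exact: vl_ideal_vabs.
Qed.

Definition yosida_point x : yosida_space e := YosidaPoint (zero_ideal_maximal x).

Lemma yosida_point_inj : injective yosida_point.
Proof.
move=> x y [xy]; apply: contrapT => nxy.
have [|_ [[a _ <-] ax ay]] := sep (@closed1 x) (@closed1 y).
  by apply/seteqP; split => // z [/= -> ].
have : zero_ideal rho x a by exact: ax.
by rewrite xy /zero_ideal /= (ay y)// => /eqP; rewrite onee_eq0.
Qed.

(** If [M] had no common zero, each point would have a neighborhood on which some positive element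
    of [M] is at least 1. By compactness one element of [M] would dominate the unit. A common zero
    gives an inclusion, which maximality makes an equality. *)
Lemma yosida_point_surj (M : yosida_space e) : exists x, yosida_point x = M.
Proof.
have [hM Me maxM] := yosida_idealP M.
suff [x Mx] : exists x, (M : set L) `<=` zero_ideal rho x.
  exists x; apply: yosida_spaceP => /=; apply: maxM => //.
    exact: (zero_ideal_ideal rep).
  by have [] := zero_ideal_maximal x.
apply: contrapT => nMx; apply: Me.
pose P (V : set X) := exists a,
  [/\ (M : set L) a, 0 <= a & forall x, V x -> (1 <= rho a x)%E].
have [a [Ma a0 a1]] : P setT.
  apply: (compact_set_ind cX).
  - by move=> A B AB [a [Ma a0 Ba]]; exists a; split=> // x /AB; exact: Ba.
  - by exists 0; split=> //; exact: vl_ideal0.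
  - move=> A B [a [Ma a0 Aa]] [b [Mb b0 Bb]].
    exists (a + b); split.
    + exact: vl_idealD.
    + by rewrite -(addr0 0); exact: vl_lerD.
    + move=> x ABx; have /(rep_leP rep)/(_ x) := vl_join_leD a0 b0.
      apply: le_trans; rewrite (rep_join rep) le_max.
      by case: ABx => [/Aa->//|/Bb->]; rewrite orbT.
  - move=> x; have [a /not_implyP[Ma ax]] : exists a, ~ ((M : set L) a -> rho a x = 0%E).
      by apply/existsNP => Mx; apply: nMx; exists x => a; exact: Mx.
    have [b [Mb b0 bx]] := vl_ideal_bump rep hM Ma ax.
    exists [set y | 1 < rho b y]%E.
      apply: open_nbhs_nbhs; split=> //.
      by apply: open_gt_cst; have [] := rep_DX rep b.
    by exists b; split=> // y /= /ltW.
apply: (vl_ideal_le hM _ (y := a)) => //.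
- by apply/(rep_leP rep) => y; rewrite (rep0 rep) unit_e lee01.
- by apply/(rep_leP rep) => y; rewrite unit_e; exact: a1.
Qed.

Lemma yosida_point_continuous : continuous yosida_point.
Proof.
apply/continuousP => _ [S ->].
have -> : yosida_point @^-1` (~` hull (u:=e) S) =
    \bigcup_(a in S) (rho a @^-1` (~` [set 0%E])).
  apply/seteqP; split=> x /=.
    by move=> /existsNP[a /not_implyP[Sa ax]]; exists a.
  by move=> [a Sa ax] h; apply: ax; exact: h.
apply: bigcup_open => a _; have [/continuousP ca _] := rep_DX rep a.
by apply: ca; apply: closed_openC; exact/accessible_closed_set1/hausdorff_accessible/ereal_hausdorff.
Qed.

Lemma yosida_homeomorphism : exists psi : yosida_space e -> X,
  [/\ continuous psi, cancel yosida_point psi & cancel psi yosida_point].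
Proof.
have [psi psiK] := choice yosida_point_surj.
have psiK' : cancel yosida_point psi.
  by move=> x; apply: yosida_point_inj; rewrite psiK.
exists psi; split=> //; apply/continuousP => O oO.
(* The preimage of [O] is the complement of the hull of the elements vanishing off [O]: separation
   provides one of them with value 1 at any given point of [O]. *)
exists [set a | forall x, ~ O x -> rho a x = 0%E].
apply/seteqP; split=> M /=.
  rewrite -{2}(psiK M) => OM; have [|_ [[a _ <-] aO aM]] := sep (open_closedC oO) (@closed1 (psi M)).
    by apply/seteqP; split => // z [/= Oz zM]; apply: Oz; rewrite zM.
  move=> /(_ a) h; have : zero_ideal rho (psi M) a by apply: h => x /aO.
  by rewrite /zero_ideal /= aM// => /eqP; rewrite onee_eq0.
by rewrite -{1}(psiK M) => h; apply: contrapT => OM; apply: h => a /(_ _ OM).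
Qed.

End YosidaUniqueness.

(** * Sublattices of [D(X)] as abstract vector lattices *)

(** Addition in [D(X)] being partial, closure under it includes the existence of the sum. *)
Record DX_lattice (R : realType) (X : topologicalType) := DXLattice {
  DX_carrier : set (X -> \bar R);
  DX_carrier_sub : DX_carrier `<=` DX X;
  DX_carrierD : forall f g, DX_carrier f -> DX_carrier g ->
    exists2 h, DX_carrier h & DX_add f g h;
  DX_carrier0 : DX_carrier (cst 0%E);
  DX_carrierZ : forall (r : R) f, DX_carrier f ->
    DX_carrier (fun x => r%:E * f x)%E;
  DX_carrier_max : forall f g, DX_carrier f -> DX_carrier g ->
    DX_carrier (fun x => maxe (f x) (g x));
  DX_carrier_min : forall f g, DX_carrier f -> DX_carrier g ->
    DX_carrier (fun x => mine (f x) (g x))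
}.

Record DX_element (R : realType) (X : topologicalType) (S : DX_lattice R X) :=
  DXElement {
    DX_fun : X -> \bar R;
    DX_funP : DX_carrier S DX_fun
  }.

HB.instance Definition _ (R : realType) (X : topologicalType)
  (S : DX_lattice R X) := gen_eqMixin (DX_element S).
HB.instance Definition _ (R : realType) (X : topologicalType)
  (S : DX_lattice R X) := gen_choiceMixin (DX_element S).

Section DXLatticeStructure.
Context {R : realType} {X : topologicalType} (S : DX_lattice R X).
Implicit Types (f g h : DX_element S) (r s : R) (x : X).

Lemma DX_elementP f g : DX_fun f = DX_fun g -> f = g.
Proof.
case: f g => [f hf] [g hg] /= fg; case: _ / fg hg => hg.
by congr DXElement; exact: Prop_irrelevance.
Qed.

Let finite f := [set x | DX_fun f x \is a fin_num].

Let DXf f : DX X (DX_fun f).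
Proof. exact/DX_carrier_sub/DX_funP. Qed.

Lemma DX_element_eq f g (D : set X) : dense D ->
  (forall x, D x -> DX_fun f x = DX_fun g x) -> f = g.
Proof. by move=> dD fg; exact/DX_elementP/(DX_eq (DXf f) (DXf g) dD). Qed.

(** Choosing a sum is harmless, since a sum in [D(X)] is determined by its values on a dense set. *)
Let add_ex f g := cid2 (DX_carrierD (DX_funP f) (DX_funP g)).

Definition DX_element_add f g := DXElement (s2valP (add_ex f g)).

Lemma DX_element_addP f g :
  DX_add (DX_fun f) (DX_fun g) (DX_fun (DX_element_add f g)).
Proof. exact: s2valP' (add_ex f g). Qed.

Definition DX_element0 : DX_element S := DXElement (DX_carrier0 S).
Definition DX_element_scale r f := DXElement (DX_carrierZ r (DX_funP f)).
Definition DX_element_opp f := DX_element_scale (-1) f.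
Definition DX_element_max f g := DXElement (DX_carrier_max (DX_funP f) (DX_funP g)).
Definition DX_element_min f g := DXElement (DX_carrier_min (DX_funP f) (DX_funP g)).
Definition DX_element_le f g := `[< forall x, (DX_fun f x <= DX_fun g x)%E >].

Let addE f g x : finite f x -> finite g x ->
  DX_fun (DX_element_add f g) x = (DX_fun f x + DX_fun g x)%E.
Proof. by have [_] := DX_element_addP f g; apply. Qed.

Let add_fin f g x : finite f x -> finite g x -> finite (DX_element_add f g) x.
Proof.
move=> fx gx; suff: DX_fun (DX_element_add f g) x \is a fin_num by [].
by rewrite addE// fin_numD; apply/andP.
Qed.

Let scaleE r f x : DX_fun (DX_element_scale r f) x = (r%:E * DX_fun f x)%E.
Proof. by []. Qed.

Let scale_fin r f x : finite f x -> finite (DX_element_scale r f) x.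
Proof. by move=> fx; rewrite /finite /= fin_numM. Qed.

(** Laws involving addition are verified only where all operands are finite; density extends them
    everywhere. *)
Let dense3 f g h : dense (finite f `&` (finite g `&` finite h)).
Proof.
have [[cf df] [cg dg]] := (DXf f, DXf g).
have [_ dh] := DXf h.
by apply: denseI; [exact: open_fin_num|by []|apply: denseI => //; exact: open_fin_num].
Qed.

Let addA : associative DX_element_add.
Proof.
move=> f g h; apply: (DX_element_eq (dense3 f g h)) => x [fx [gx hx]].
by rewrite !addE ?addeA//; exact: add_fin.
Qed.

Let addC : commutative DX_element_add.
Proof.
move=> f g; apply: (DX_element_eq (dense3 f g g)) => x [fx [gx _]].
by rewrite !addE// addeC.
Qed.

Let add0 : left_id DX_element0 DX_element_add.
Proof.
move=> f; apply: (DX_element_eq (dense3 f f f)) => x [fx _].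
by rewrite addE// /= add0e.
Qed.

Let addN : left_inverse DX_element0 DX_element_opp DX_element_add.
Proof.
move=> f; apply: (DX_element_eq (dense3 f f f)) => x [fx _].
rewrite addE//=; last exact: scale_fin.
by rewrite EFinN mulN1e addeC subee.
Qed.

HB.instance Definition _ := GRing.isZmodule.Build (DX_element S) addA addC add0 addN.

Let scaleA r s f :
  DX_element_scale r (DX_element_scale s f) = DX_element_scale (r * s) f.
Proof. by apply/DX_elementP/funext => x /=; rewrite EFinM muleA. Qed.

Let scale1 : left_id 1 DX_element_scale.
Proof. by move=> f; apply/DX_elementP/funext => x /=; rewrite mul1e. Qed.

Let scaleDr : right_distributive DX_element_scale +%R.
Proof.
move=> r f g; apply: (DX_element_eq (dense3 f g g)) => x [fx [gx _]].
rewrite scaleE !addE//; try exact: scale_fin.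
by rewrite !scaleE muleDr// fin_num_adde_defr.
Qed.

Let scaleDl f : {morph DX_element_scale^~ f : r s / r + s}.
Proof.
move=> r s; apply: (DX_element_eq (dense3 f f f)) => x [fx _].
rewrite addE; try exact: scale_fin.
by rewrite !scaleE EFinD muleDl.
Qed.

HB.instance Definition _ := GRing.Zmodule_isLmodule.Build R (DX_element S)
  scaleA scale1 scaleDr scaleDl.

Let le_refl : reflexive DX_element_le.
Proof. by move=> f; apply/asboolP => x. Qed.

Let le_anti : antisymmetric DX_element_le.
Proof.
move=> f g /andP[/asboolP fg /asboolP gf].
by apply/DX_elementP/funext => x; apply/le_anti; rewrite fg gf.
Qed.

Let le_trans : transitive DX_element_le.
Proof.
move=> g f h /asboolP fg /asboolP gh.
by apply/asboolP => x; exact: le_trans (fg x) (gh x).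
Qed.

HB.instance Definition _ := Order.Le_isPOrder.Build ring_display (DX_element S)
  le_refl le_anti le_trans.

Let joinP f g h : (DX_element_max f g <= h) = (f <= h) && (g <= h).
Proof.
apply/asboolP/andP => [fgh|[/asboolP fh /asboolP gh] x /=].
  by split; apply/asboolP => x; have := fgh x; rewrite /= ge_max => /andP[].
by rewrite ge_max fh gh.
Qed.

Let meetP f g h : (h <= DX_element_min f g) = (h <= f) && (h <= g).
Proof.
apply/asboolP/andP => [fgh|[/asboolP fh /asboolP gh] x /=].
  by split; apply/asboolP => x; have := fgh x; rewrite /= le_min => /andP[].
by rewrite le_min fh gh.
Qed.

Let leD2r h f g : f <= g -> f + h <= g + h.
Proof.
(* The inequality is recast as an equation between elements, which may be checked on a dense set. *)
move=> /asboolP fg; have <- : DX_element_max (f + h) (g + h) = g + h.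
  apply: (DX_element_eq (dense3 f g h)) => x [fx [gx hx]].
  suff: maxe (DX_fun (f + h) x) (DX_fun (g + h) x) = DX_fun (g + h) x by [].
  by rewrite !addE//; apply/max_idPr; exact: leeD2r.
by apply/asboolP => x /=; rewrite le_max lexx.
Qed.

Let scale_ge0 r f : 0 <= r -> 0 <= f -> 0 <= r *: f.
Proof.
by move=> r0 /asboolP f0; apply/asboolP => x /=; rewrite mule_ge0//; exact: f0.
Qed.

HB.instance Definition _ := Lmodule_isVectorLattice.Build R (DX_element S)
  joinP meetP leD2r scale_ge0.

Lemma DX_fun_representation :
  DX_representation (@DX_fun R X S).
Proof.
split=> //; [exact: DX_elementP|exact: DX_element_addP].
Qed.

Lemma range_DX_fun : range (@DX_fun R X S) = DX_carrier S.
Proof.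
apply/seteqP; split=> [_ [f _ <-]|f Sf]; first exact: DX_funP.
by exists (DXElement Sf).
Qed.

End DXLatticeStructure.

(** * Transport along a homeomorphism and uniqueness of the Yosida representation *)

Section Transport.
Context {R : realType} {L : vectorLatticeType R} {X Z : topologicalType}.
Variables (rho : L -> X -> \bar R) (phi : X -> Z) (psi : Z -> X).
Hypotheses (cphi : continuous phi) (cpsi : continuous psi).
Hypotheses (phiK : cancel phi psi) (psiK : cancel psi phi).

Lemma DX_comp_homeo (f : X -> \bar R) : DX X f -> DX Z (f \o psi).
Proof.
move=> [cf df]; split; first by move=> z; apply: continuous_comp; [exact: cpsi|exact: cf].
move=> O [z Oz] oO; have [||x [/= Ox fx]] := df (phi @^-1` O).
- by exists (psi z); rewrite /= psiK.
- by move/continuousP: cphi; apply.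
- by exists (phi x); split=> //=; rewrite phiK.
Qed.

Lemma DX_representation_homeo :
  DX_representation rho -> DX_representation (fun a => rho a \o psi).
Proof.
move=> rep; split.
- move=> a b ab; apply: (rep_inj rep); apply/funext => x.
  by have /(congr1 (@^~ (phi x))) := ab; rewrite /= phiK.
- by move=> a; apply: DX_comp_homeo; exact: (rep_DX rep).
- move=> a b; split; first exact/DX_comp_homeo/(rep_DX rep).
  by move=> z; exact: (repD rep).
- by move=> r a; rewrite (rep_scale rep).
- by move=> a b; rewrite (rep_join rep).
- by move=> a b; rewrite (rep_meet rep).
Qed.

Lemma zero_one_separates_homeo :
  zero_one_separates (range rho) -> zero_one_separates (range (fun a => rho a \o psi)).
Proof.
move=> sep E F cE cF EF0.
have [|||_ [[a _ <-] aE aF]] := sep (phi @^-1` E) (phi @^-1` F).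
- by move/continuous_closedP: cphi; apply.
- by move/continuous_closedP: cphi; apply.
- by rewrite -preimage_setI EF0 preimage_set0.
exists (rho a \o psi); split; first by exists a.
- by move=> z Ez; apply: aE; rewrite /= psiK.
- by move=> z Fz; apply: aF; rewrite /= psiK.
Qed.

Lemma compact_homeo : compact [set: X] -> compact [set: Z].
Proof.
move=> cX; have -> : [set: Z] = phi @` [set: X].
  by apply/seteqP; split=> // z _; exists (psi z).
by apply: continuous_compact => //; exact: continuous_subspaceT.
Qed.

Lemma hausdorff_homeo : hausdorff_space X -> hausdorff_space Z.
Proof.
move=> hX z w zw; apply: (can_inj psiK); apply: hX => A B Az Bw.
have [t [/= At Bt]] := zw _ _ (cpsi Az) (cpsi Bw).
by exists (psi t).
Qed.

End Transport.

Lemma yosida_space_isP (R : realType) (L : vectorLatticeType R) (e : L)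
    (X : topologicalType) (rho : L -> X -> \bar R) :
  DX_representation rho -> rho e = cst 1%E -> compact [set: X] ->
  hausdorff_space X -> zero_one_separates (range rho) -> yosida_space_is e rho.
Proof.
move=> rep rhoe cX hX sep.
have cphi := @yosida_point_continuous _ _ _ _ _ rep rhoe hX sep.
have [psi [cpsi phiK psiK]] := yosida_homeomorphism rep rhoe cX hX sep.
exists (fun a => rho a \o psi), (yosida_point rep rhoe hX sep), psi; split=> //.
- split.
  + exact: (DX_representation_homeo cphi).
  + by rewrite rhoe.
  + exact: (zero_one_separates_homeo cphi).
- by move=> a; apply/funext => x /=; rewrite phiK.
Qed.

(* Both spaces are identified with the Yosida space by sending a point to its
   zero ideal. *)
Lemma yosida_representation_unique (R : realType) (L : vectorLatticeType R)
    (e : L) (X : topologicalType) (rho : L -> X -> \bar R)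
    (eta : L -> yosida_space e -> \bar R) :
  DX_representation rho -> rho e = cst 1%E -> compact [set: X] ->
  hausdorff_space X -> zero_one_separates (range rho) ->
  yosida_representation eta ->
  exists (s : yosida_space e -> X) (t : X -> yosida_space e),
    [/\ continuous s, continuous t, cancel s t, cancel t s &
        forall a, eta a = rho a \o s].
Proof.
move=> rep rhoe cX hX sep [erep etae esep].
pose phi := yosida_point rep rhoe hX sep.
have cphi : continuous phi := @yosida_point_continuous _ _ _ _ _ rep rhoe hX sep.
have [psi [cpsi phiK psiK]] := yosida_homeomorphism rep rhoe cX hX sep.
(* The Yosida space inherits compactness and the Hausdorff property from [X], so the zero-ideal
   construction applies to [eta] as well. *)
have cZ : compact [set: yosida_space e] := compact_homeo cphi psiK cX.
have hZ : hausdorff_space (yosida_space e) := hausdorff_homeo cpsi psiK hX.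
pose phi' := yosida_point erep etae hZ esep.
have cphi' : continuous phi' := @yosida_point_continuous _ _ _ _ _ erep etae hZ esep.
have [psi' [cpsi' phiK' psiK']] := yosida_homeomorphism erep etae cZ hZ esep.
exists (psi \o phi'), (psi' \o phi); split.
- by move=> z; apply: continuous_comp; [exact: cphi'|exact: cpsi].
- by move=> x; apply: continuous_comp; [exact: cphi|exact: cpsi'].
- by move=> z; exact: etrans (congr1 psi' (psiK _)) (phiK' z).
- by move=> x; exact: etrans (congr1 psi (psiK' _)) (phiK x).
move=> a; apply/funext => z; apply/esym.
apply: (rep_value_eq rep erep rhoe etae).
(* The equation [phi (psi (phi' z)) = phi' z] says that [rho] at [psi (phi' z)] and [eta] at [z]
   have the same zero ideal. *)
by have /(congr1 (@yosida_ideal _ _ _)) := psiK (phi' z).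
Qed.

(** * Covers and clopen sets *)

(** For [O] open and nonempty, the image of its complement is closed and, by irreducibility, proper.
    So [D] contains a point outside that image, and all preimages of this point lie in [O]. *)
Lemma cover_dense (X Y : topologicalType) (tau : X -> Y) (D : set Y) :
  is_cover tau -> open D -> dense D -> dense (tau @^-1` D).
Proof.
move=> [[cX hX] [cY hY] ctau rtau irr] oD dD O [x Ox] oO.
have cO : closed (~` O) by exact: open_closedC.
have NO : ~` O != [set: X].
  by apply/eqP => OT; have : (~` O) x by rewrite OT.
have ctO : closed (tau @` (~` O)).
  apply: compact_closed => //; apply: continuous_compact.
    exact: continuous_subspaceT.
  exact: (subclosed_compact cO cX).
have [|y [/= ytO Dy]] := dD (~` (tau @` (~` O))) _ (closed_openC ctO).
  apply: contrapT => /nonemptyPn tO0.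
  by move/eqP: (irr _ cO NO); apply; rewrite -[LHS]setCK tO0 setC0.
have [z _ zy] : range tau y by rewrite rtau.
exists z; split; last by rewrite /= zy.
by apply: contrapT => Oz; apply: ytO; exists z.
Qed.

Lemma DX_cover (R : realType) (X Y : topologicalType) (tau : X -> Y)
  (f : Y -> \bar R) : is_cover tau -> DX Y f -> DX X (f \o tau).
Proof.
move=> tauP [cf df]; have [_ _ ctau _ _] := tauP; split.
  by move=> x; apply: continuous_comp; [exact: ctau|exact: cf].
exact: (cover_dense tauP (open_fin_num cf) df).
Qed.

Section Patch.
Context {R : realType} {X : Type}.
Implicit Types (f : X -> \bar R) (U : set X).

Lemma patch_inE f U x : U x -> (f \_ U) x = f x.
Proof. by move=> Ux; rewrite patchE mem_set. Qed.

Lemma patch_notinE f U x : ~ U x -> (f \_ U) x = 0%E.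
Proof. by move=> Ux; rewrite patchE memNset. Qed.

End Patch.

Lemma clopen_nbhs (X : topologicalType) (x : X) (N : set X) :
  has_clopen_base X -> nbhs x N -> exists W, [/\ clopen W, W x & W `<=` N].
Proof. by move=> [_ zd] /zd[W [cW Wx] WN]; exists W. Qed.

Lemma clopen_separates (X : topologicalType) (E F : set X) :
  compact [set: X] -> has_clopen_base X -> closed E -> closed F ->
  E `&` F = set0 -> exists W, [/\ clopen W, F `<=` W & E `&` W = set0].
Proof.
move=> cX zd cE cF EF0.
pose P (V : set X) := exists W, [/\ clopen W, F `&` V `<=` W & E `&` W = set0].
suff [W [cW FW EW]] : P setT by exists W; split=> //; rewrite setIT in FW.
apply: (compact_set_ind cX).
- move=> A B AB [W [cW BW EW]]; exists W; split=> //.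
  by move=> x [Fx /AB Bx]; exact: BW.
- exists set0; split; [by split; [exact: open0|exact: closed0]| |by rewrite setI0].
  by rewrite setI0.
- move=> A B [W [[oW cW] AW EW]] [W' [[oW' cW'] BW' EW']]; exists (W `|` W'); split.
  + by split; [exact: openU|exact: closedU].
  + by rewrite setIUr; exact: setUSS.
  + by rewrite setIUr EW EW' setU0.
- move=> x; have [Fx|Fx] := pselect (F x).
    have [|W [cW Wx WE]] := clopen_nbhs zd (x := x) (N := ~` E).
      apply: open_nbhs_nbhs; split; first exact: closed_openC.
      by move=> Ex; have : (E `&` F) x by []; rewrite EF0.
    exists W; first by apply: open_nbhs_nbhs; split=> //; case: cW.
    exists W; split; [exact: cW|by move=> y []|].
    by apply/seteqP; split=> // y [Ey /WE].
  exists (~` F); first by apply: open_nbhs_nbhs; split=> //; exact: closed_openC.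
  exists set0; split; [by split; [exact: open0|exact: closed0]| |by rewrite setI0].
  by rewrite setICr.
Qed.

(** * Local pullbacks and the group they form *)

Section LocalPullback.
Context {R : realType} {A : vectorLatticeType R} {X Y : topologicalType}.
Variables (eta : A -> Y -> \bar R) (tau : X -> Y).
Hypothesis rep : DX_representation eta.
Hypothesis tauP : is_cover tau.
Implicit Types (f g h : X -> \bar R) (a b : A) (U : set X).

Definition local_pullback : set (X -> \bar R) :=
  [set f | forall x : X, exists a, \forall y \near x, f y = eta a (tau y)].

Let DX_pull a : DX X (eta a \o tau).
Proof. by apply: DX_cover => //; exact: (rep_DX rep). Qed.

Lemma local_pullback_DX : local_pullback `<=` DX X.
Proof.
move=> f lf; apply: DX_local => x; have [a fa] := lf x.
by exists (eta a \o tau).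
Qed.

Lemma local_pullback_pull a : local_pullback (eta a \o tau).
Proof. by move=> x; exists a; exact: nearW. Qed.

(** The representatives [a y] and [b y] are chosen independently at each point. This does not
    matter: two choices valid near a point have sums agreeing on a dense set there, hence at the
    point. *)
Lemma local_pullbackD f g : local_pullback f -> local_pullback g ->
  exists2 h, local_pullback h & DX_add f g h.
Proof.
move=> lf lg; have [a fa] := choice lf; have [b gb] := choice lg.
pose h y := eta (a y + b y) (tau y).
have lh : local_pullback h.
  move=> x; exists (a x + b x).
  (* Interiors are taken so that the representatives chosen at [x] remain valid on a neighborhood of
     [y]. *)
  apply: filterS (filterI (nbhs_interior (fa x)) (nbhs_interior (gb x))).
  move=> y [/= fx gx].
  apply: (DX_eq_near (DX_pull (a y + b y)) (DX_pull (a x + b x))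
           (dense_fin_num2 (local_pullback_DX lf) (local_pullback_DX lg))).
  apply: filterS (filterI (filterI fx (fa y)) (filterI gx (gb y))).
  move=> z /= [[fxz fyz] [gxz gyz]] [fz gz].
  by rewrite !(repD rep) -?fxz -?fyz -?gxz -?gyz.
exists h => //; split; first exact: local_pullback_DX.
move=> x fx gx; rewrite /h.
have fE : f x = eta (a x) (tau x) := nbhs_singleton (fa x).
have gE : g x = eta (b x) (tau x) := nbhs_singleton (gb x).
by rewrite (repD rep) -?fE -?gE.
Qed.

Lemma local_pullbackZ (r : R) f :
  local_pullback f -> local_pullback (fun x => r%:E * f x)%E.
Proof.
move=> lf x; have [a fa] := lf x; exists (r *: a); apply: filterS fa => y ->.
by rewrite (rep_scale rep).
Qed.

Lemma local_pullback_max f g : local_pullback f -> local_pullback g ->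
  local_pullback (fun x => maxe (f x) (g x)).
Proof.
move=> lf lg x; have [a fa] := lf x; have [b gb] := lg x.
exists (vl_join a b); apply: filterS (filterI fa gb) => y [-> ->].
by rewrite (rep_join rep).
Qed.

Lemma local_pullback_min f g : local_pullback f -> local_pullback g ->
  local_pullback (fun x => mine (f x) (g x)).
Proof.
move=> lf lg x; have [a fa] := lf x; have [b gb] := lg x.
exists (vl_meet a b); apply: filterS (filterI fa gb) => y [-> ->].
by rewrite (rep_meet rep).
Qed.

Lemma local_pullback0 : local_pullback (cst 0%E).
Proof. by move=> x; exists 0; apply: nearW => y; rewrite (rep0 rep). Qed.

Definition local_pullback_lattice : DX_lattice R X :=
  DXLattice local_pullback_DX local_pullbackD local_pullback0
    local_pullbackZ local_pullback_max local_pullback_min.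

Lemma local_pullback_patch f U :
  clopen U -> local_pullback f -> local_pullback (f \_ U).
Proof.
move=> [oU cU] lf x; have [Ux|Ux] := pselect (U x).
  have [a fa] := lf x; exists a.
  have nU : nbhs x U by apply: open_nbhs_nbhs.
  by apply: filterS (filterI nU fa) => y [Uy <-]; rewrite patch_inE.
have nU : nbhs x (~` U) by apply: open_nbhs_nbhs; split=> //; exact: closed_openC.
by exists 0; apply: filterS nU => y Uy; rewrite patch_notinE// (rep0 rep).
Qed.

Lemma DX_subgroup_local_pullback : DX_subgroup local_pullback.
Proof.
split.
- exact: local_pullback_DX.
- exact: local_pullback0.
- move=> f /(local_pullbackZ (-1)); congr local_pullback.
  by apply/funext => x; rewrite EFinN mulN1e.
- move=> f g h lf lg fgh; have [h' lh' fgh'] := local_pullbackD lf lg.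
  by rewrite (DX_add_unique (local_pullback_DX lf) (local_pullback_DX lg) fgh fgh').
Qed.

(* By compactness a local pullback is a finite sum over a clopen partition. *)
Lemma local_pullbackE : has_clopen_base X ->
  smallest DX_subgroup
    [set f | exists a U, clopen U /\ f = (eta a \o tau) \_ U] = local_pullback.
Proof.
move=> zd; apply/seteqP; split.
  apply: smallest_sub; first exact: DX_subgroup_local_pullback.
  by move=> _ [a [U [cU ->]]]; exact/local_pullback_patch/local_pullback_pull.
move=> f lf M [[_ M0 _ MD] gM].
(* Quantifying over all clopen subsets of [W] allows overlapping pieces to be made disjoint in the
   union step. *)
pose P (V : set X) := exists W, [/\ clopen W, V `<=` W &
  forall U, clopen U -> U `<=` W -> M (f \_ U)].
have [[cX _] _ _ _ _] := tauP.
suff [W [_ TW MW]] : P setT.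
  have -> : f = f \_ setT by apply/funext => x; rewrite patch_inE.
  by apply: MW => //; split; [exact: openT|exact: closedT].
apply: (compact_set_ind cX).
- by move=> A1 B AB [W [cW BW MW]]; exists W; split=> //; exact: subset_trans BW.
- exists set0; split=> //; first by split; [exact: open0|exact: closed0].
  move=> U _ U0; suff -> : f \_ U = cst 0%E by [].
  by apply/funext => x; rewrite patch_notinE// => /U0.
- move=> B B' [W [[oW cW] BW MW]] [W' [[oW' cW'] BW' MW']]; exists (W `|` W').
  split; [by split; [exact: openU|exact: closedU]|exact: setUSS|].
  move=> U [oU cU] UWW.
  (* [U] is split into its parts inside and outside [W], so that at each point at most one summand
     is nonzero. *)
  apply: (MD (f \_ (U `&` W)) (f \_ (U `&` ~` W))).
  + apply: MW; last by move=> x [].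
    by split; [exact: openI|exact: closedI].
  + apply: MW'; last by move=> x [/UWW[]].
    by split; [apply: openI => //; exact: closed_openC|
               apply: closedI => //; exact: open_closedC].
  + split; first exact/local_pullback_DX/local_pullback_patch.
    move=> x _ _; have [Ux|Ux] := pselect (U x); last first.
      by rewrite !patch_notinE ?adde0// => -[].
    have [Wx|Wx] := pselect (W x).
      by rewrite [X in _ = _ + X]patch_notinE ?adde0 ?patch_inE// => -[].
    by rewrite [X in _ = X + _]patch_notinE ?add0e ?patch_inE// => -[].
- move=> x; have [a fa] := lf x; have [W [cW Wx Wa]] := clopen_nbhs zd fa.
  exists W; first by apply: open_nbhs_nbhs; split=> //; case: cW.
  exists W; split=> // U cU UW; apply: gM; exists a, U; split=> //.
  apply/funext => y; have [Uy|Uy] := pselect (U y).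
    by rewrite !patch_inE//; exact/Wa/UW.
  by rewrite !patch_notinE.
Qed.

End LocalPullback.

(** * Separation, unit and projection bands in a represented lattice *)

Lemma clopen_patch_separates (R : realType) (L : vectorLatticeType R) (e : L)
  (X : topologicalType) (rho : L -> X -> \bar R) :
  compact [set: X] -> has_clopen_base X -> rho e = cst 1%E ->
  (forall a U, clopen U -> exists b, rho b = rho a \_ U) ->
  zero_one_separates (range rho).
Proof.
move=> cX zd rhoe patch E F cE cF EF0.
have [W [cW FW EW]] := clopen_separates cX zd cE cF EF0.
have [b bE] := patch e W cW; exists (rho b); split; first by exists b.
  move=> x Ex; rewrite bE patch_notinE// => Wx.
  by have : (E `&` W) x by []; rewrite EW.
by move=> x /FW Wx; rewrite bE patch_inE// rhoe.
Qed.

Section Consequences.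
Context {R : realType} {L : vectorLatticeType R} {X : topologicalType}.
Variables (e : L) (rho : L -> X -> \bar R).
Hypothesis rep : DX_representation rho.
Hypothesis rhoe : rho e = cst 1%E.

(** The archimedean property of the reals applies on the dense set where [a] and [b] are both
    finite. *)
Lemma rep_archimedean : archimedean_vl L.
Proof.
move=> a b /(rep_leP rep) a0 nab; apply: (rep_inj rep).
apply: (DX_eq (rep_DX rep a) (rep_DX rep 0)
         (dense_fin_num2 (rep_DX rep a) (rep_DX rep b))) => x [afin bfin].
rewrite (rep0 rep).
have a0x := a0 x.
have nabx n : (n%:R%:E * rho a x <= rho b x)%E.
  by rewrite -(repMn rep)//; move/(rep_leP rep): (nab n).
rewrite (rep0 rep) in a0x.
case: (rho a x) (rho b x) afin bfin a0x nabx => [r| |] [s| |] // _ _.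
rewrite lee_fin le_eqVlt => /predU1P[<-//|r0] nrs.
have s0 : 0 <= s by have := nrs 0%N; rewrite mul0e lee_fin.
have := archi_boundP (divr_ge0 s0 (ltW r0)).
rewrite ltr_pdivrMr// ltNge => /negP[].
by have := nrs (Num.bound (s / r)); rewrite -EFinM lee_fin.
Qed.

(** The point [x0] guarantees that the constant 1 differs from 0. *)
Lemma rep_weak_order_unit (x0 : X) : weak_order_unit e.
Proof.
split.
  rewrite lt_def; apply/andP; split.
    apply/eqP => e0; have := rep0 rep x0.
    by rewrite -e0 rhoe => /eqP; rewrite onee_eq0.
  by apply/(rep_leP rep) => x; rewrite rhoe (rep0 rep) lee01.
move=> a ae0; apply: (rep_eqP rep) => x; rewrite (rep0 rep).
have := rep0 rep x; rewrite -ae0 (rep_meet rep) (rep_vabs rep) rhoe.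
rewrite minElt; case: ifPn => [_ /eqP|_ /eqP]; last by rewrite onee_eq0.
by rewrite abse_eq0 => /eqP.
Qed.

Hypothesis zd : has_clopen_base X.
Hypothesis patch : forall a U, clopen U -> exists b, rho b = rho a \_ U.

Definition vanishing_off (U : set X) : set L :=
  [set a | forall x, ~ U x -> rho a x = 0%E].

Lemma vanishing_off_band U : clopen U -> band (vanishing_off U).
Proof.
move=> cU; split.
  split=> /=.
  - by move=> x _; exact: rep0.
  - by move=> a b Ua Ub x Ux; rewrite (repD rep) ?Ua ?Ub ?adde0.
  - by move=> r a Ua x Ux; rewrite (rep_scale rep) Ua// mule0.
  - move=> a b ab Ub x Ux.
    exact: (vl_ideal_solid (zero_ideal_ideal rep x) ab (Ub x Ux)).
move=> S s SU [ubs leasts] x Ux; have [b bE] := patch s cU.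
(* [b] is [s] cut down to [U], which is still an upper bound of [S]; hence [s] is at most 0 off
   [U]. *)
have sb : s <= b.
  apply: leasts => c Sc; apply/(rep_leP rep) => y; rewrite bE.
  have [Uy|Uy] := pselect (U y); last by rewrite patch_notinE// (SU c Sc).
  by rewrite patch_inE//; move/(rep_leP rep): (ubs c Sc).
have s0 : (rho s x <= 0)%E.
  by move/(rep_leP rep)/(_ x): sb; rewrite bE patch_notinE.
apply/le_anti; rewrite s0 /=.
have [[c Sc]|S0] := pselect (S !=set0).
  by rewrite -(SU c Sc x Ux); move/(rep_leP rep): (ubs c Sc).
(* For empty [S] every element is an upper bound, so [s] would be a least element. *)
exfalso; have : s <= s - e.
  by apply: leasts => c Sc; case: S0; exists c.
rewrite -vl_subr_ge0 addrC addrA addNr add0r => /(rep_leP rep)/(_ x).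
by rewrite (rep0 rep) (repN rep) rhoe oppe_ge0 leNgt lte01.
Qed.

Lemma vanishing_off_projection_band U :
  clopen U -> projection_band (vanishing_off U).
Proof.
move=> cU; have cUC : clopen (~` U).
  by case: cU => oU cU; split; [exact: closed_openC|exact: open_closedC].
split; first exact: vanishing_off_band.
exists (vanishing_off (~` U)); split; first exact: vanishing_off_band.
  apply/seteqP; split=> [a [aU aUC]|_ ->] /=; last first.
    by split=> x _; rewrite (rep0 rep).
  apply: (rep_eqP rep) => x; rewrite (rep0 rep).
  by have [Ux|Ux] := pselect (U x); [apply: aUC => /(_ Ux)|exact: aU].
move=> g; have [b bE] := patch g cU; have [b' b'E] := patch g cUC.
exists b, b'; split.
- by move=> x Ux; rewrite bE patch_notinE.
- by move=> x Ux; rewrite b'E patch_notinE.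
apply: (rep_inj rep); apply: (DX_eq (rep_DX rep _) (rep_DX rep _)
  (dense_fin_num2 (rep_DX rep b) (rep_DX rep b'))) => x [bfin b'fin].
rewrite (repD rep)// bE b'E; have [Ux|Ux] := pselect (U x).
  by rewrite patch_inE// patch_notinE ?adde0// => /(_ Ux).
by rewrite patch_notinE// patch_inE ?add0e.
Qed.

(* An element [a] vanishing off [U] is recovered as the supremum of the
   bounded truncations [|a| /\ n chi(U)]. *)
Lemma vanishing_off_sub_band (B : set L) (U : set X) (c : L) : band B ->
  B c -> rho c = cst 1%E \_ U -> vanishing_off U `<=` B.
Proof.
move=> [hB supB] Bc cE a aU; apply: vl_ideal_vabs_inv => //.
have c0 : 0 <= c.
  apply/(rep_leP rep) => x; rewrite cE (rep0 rep).
  by have [Ux|Ux] := pselect (U x); [rewrite patch_inE//= lee01|rewrite patch_notinE].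
pose t (n : nat) := vl_meet (vabs a) (n%:R *: c).
apply: (supB (range t)).
  move=> _ [n _ <-]; apply: (vl_ideal_le hB (y := n%:R *: c)).
  - by rewrite vl_lexI vabs_ge0 vl_scale_ge0.
  - by have := lexx (t n); rewrite vl_lexI => /andP[].
  - exact: vl_idealZ.
split.
  by move=> _ [n _ <-]; have := lexx (t n); rewrite vl_lexI => /andP[].
move=> h ubh; apply/(rep_leP rep) => x; rewrite (rep_vabs rep).
have th n : (mine `|rho a x| (n%:R%:E * rho c x) <= rho h x)%E.
  have /(rep_leP rep)/(_ x) : t n <= h by apply: ubh; exists n.
  by rewrite (rep_meet rep) (rep_vabs rep) (rep_scale rep).
have [Ux|Ux] := pselect (U x); last first.
  by have := th 0%N; rewrite (aU x Ux) abse0 mul0e minxx.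
have {}th n : (mine `|rho a x| n%:R%:E <= rho h x)%E.
  by have := th n; rewrite cE patch_inE// mule1.
(* If [|a|] is finite at [x], a truncation with large [n] equals it there; if it is infinite, [h]
   bounds every [n] at [x] and is infinite too. *)
case: `|rho a x|%E (abse_ge0 (rho a x)) th => [r| |//] _ th.
  have := th (Num.truncn r).+1; rewrite min_l// lee_fin.
  by apply: ltW; exact: truncnS_gt.
have {}th n : (n%:R%:E <= rho h x)%E.
  by have := th n; rewrite min_r// leey.
case: (rho h x) th => [r th|//|th]; last by have := th 0%N.
by have := th (Num.truncn r).+1; rewrite lee_fin leNgt truncnS_gt.
Qed.

Lemma rep_sufficiently_many_projections : sufficiently_many_projections L.
Proof.
move=> B bandB Bn0; have [hB _] := bandB.
have [a Ba a0] : exists2 a, B a & a <> 0.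
  apply: contrapT => na; apply: Bn0; apply/seteqP; split=> [a Ba|_ ->] /=.
    by apply: contrapT => a0; apply: na; exists a.
  exact: vl_ideal0.
have [x ax] : exists x, rho a x <> 0%E.
  apply/existsNP => a0'; apply: a0; apply: (rep_eqP rep) => x.
  by rewrite a0' (rep0 rep).
have [b [Bb b0 bx]] := vl_ideal_bump rep hB Ba ax.
have [|U [cU Ux Ub]] := clopen_nbhs zd (x := x) (N := [set y | 1 < rho b y]%E).
  apply: open_nbhs_nbhs; split=> //.
  by apply: open_gt_cst; have [] := rep_DX rep b.
(* [c] is the characteristic function of [U]; it lies in [B] because [0 <= c <= b]. *)
have [c cE] := patch e cU; rewrite rhoe in cE.
exists (vanishing_off U); split.
- exact: vanishing_off_projection_band.
- move=> /seteqP[/(_ c) h _].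
  have : c = 0 by apply: h => y Uy; rewrite cE patch_notinE.
  move/(congr1 (rho ^~ x)); rewrite cE patch_inE// (rep0 rep) => /eqP.
  by rewrite onee_eq0.
apply: (vanishing_off_sub_band bandB _ cE).
apply: (vl_ideal_le hB _ _ Bb); apply/(rep_leP rep) => y; rewrite cE.
  rewrite (rep0 rep).
  by have [Uy|Uy] := pselect (U y); [rewrite patch_inE//= lee01|rewrite patch_notinE].
have [Uy|Uy] := pselect (U y); first by rewrite patch_inE//; exact/ltW/Ub.
by rewrite patch_notinE// -(rep0 rep y); move/(rep_leP rep): b0.
Qed.

End Consequences.

Theorem theorem5p2 (R : realType) (A : vectorLatticeType R) (u : A)
    (eta : A -> yosida_space u -> \bar R)
    (X : topologicalType) (tau : X -> yosida_space u)
    (archA : archimedean_vl A) (unit_u : weak_order_unit u)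
    (eta_yosida : yosida_representation eta)
    (tau_cover : is_cover tau) (X_zd : has_clopen_base X) :
  exists (G : vectorLatticeType R) (e : G) (rho : G -> X -> \bar R),
    [/\ (* G(A, tau) is a vector lattice in D(X), with unit the constant 1 *)
        [/\ DX_representation rho, range rho = cover_group eta tau,
            rho e = cst 1%E, archimedean_vl G & weak_order_unit e],
        (* YG = X *)
        yosida_space_is e rho,
        forall etaG : G -> yosida_space e -> \bar R,
          yosida_representation etaG ->
          lambda_clopens (range etaG) = [set U | clopen U] /\
          is_local (range etaG) &
        sufficiently_many_projections G].
Proof.
have [arep etau _] := eta_yosida.
have [[cX hX] _ _ rtau _] := tau_cover.
(* If [X] were empty, so would be the Yosida space of [A], and injectivity of [eta] would force
   [u = 0]. *)
have [x0 _] : [set: X] !=set0.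
  apply: contrapT => X0; have [u0 _] := unit_u.
  suff uE : u = 0 by move: u0; rewrite uE ltxx.
  apply: (rep_eqP arep) => y; exfalso; apply: X0.
  by have [x _ _] : range tau y by [rewrite rtau]; exists x.
pose S := local_pullback_lattice arep tau_cover.
pose rho : DX_element S -> X -> \bar R := @DX_fun R X S.
have rep : DX_representation rho := DX_fun_representation S.
have ran : range rho = local_pullback eta tau := range_DX_fun S.
have l1 : local_pullback eta tau (cst 1%E).
  by have := local_pullback_pull eta tau u; rewrite etau.
pose e : DX_element S := @DXElement R X S _ l1.
have rhoe : rho e = cst 1%E by [].
have patch (a : DX_element S) U : clopen U -> exists b, rho b = rho a \_ U.
  move=> cU; have : range rho (rho a \_ U).
    by rewrite ran; apply: local_pullback_patch => //; exact: (DX_funP a).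
  by case=> b _ <-; exists b.
have sep := clopen_patch_separates cX X_zd rhoe patch.
exists (DX_element S), e, rho; split.
- split=> //; first by rewrite ran -local_pullbackE.
  + exact: (rep_archimedean rep).
  + exact: (rep_weak_order_unit rep rhoe x0).
- exact: yosida_space_isP.
- move=> etaG etaGP.
  (* Both claims are carried from an arbitrary Yosida representation to [rho] through the
     homeomorphisms [s] and [t]. *)
  have [s [t [cs ct sK tK etaGE]]] :=
    yosida_representation_unique rep rhoe cX hX sep etaGP.
  split.
    apply/seteqP; split=> [U []//|U [oU cU]]; split=> // _ [a _ <-].
    have [|b bE] := patch a (t @^-1` U).
      by split; [move/continuousP: ct; apply|move/continuous_closedP: ct; apply].
    exists b => //; rewrite !etaGE bE; apply/funext => z /=.
    have [Uz|Uz] := pselect (U z); first by rewrite !patch_inE//= sK.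
    by rewrite !patch_notinE//= sK.
  (* Near each point [f \o t] agrees with a local pullback, so it is itself a local pullback. *)
  move=> f [Df lf]; have : range rho (f \o t).
    rewrite ran => x; have [_ [b _ <-] fb] := lf (t x).
    have [a ba] := DX_funP b x; exists a.
    apply: filterS (filterI ba (ct x _ fb)) => y [/= <- ->].
    by rewrite etaGE /= tK.
  case=> b _ bE; exists b => //; rewrite etaGE bE; apply/funext => z /=.
  by rewrite sK.
- exact: (rep_sufficiently_many_projections rep rhoe X_zd patch).
Qed.
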